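(* For any nontrivial minor-closed graph property $P$, there exists a graph $G$ of maximum degree five whose $P$ split thickness is at least $3$.
   Context: Graphs are finite and simple. For a positive integer $k$, a $k$-split operation at a vertex $v$ of a graph inserts at most $k$ new vertices $v_1,\dots,v_k$ (the copies of $v$), then, for each neighbor $w$ of $v$, adds at least one edge $(v_i,w)$ with $i\in[1,k]$, and finally deletes $v$ along with its incident edges. A $k$-split of a graph $G$ is a graph obtained by applying a $k$-split operation to each vertex of $G$ at most once. For a graph property $P$, $G$ is $k$-splittable into $P$ if some $k$-split of $G$ has property $P$. The $P$ split thickness of $G$ is the minimum positive integer $k$ such that $G$ is $k$-splittable into $P$ (regarded as infinite if there is no such $k$). A minor-closed property is one that is preserved under taking minors; it is nontrivial if some graphs but not all graphs have it. *)

(* Defs.v *)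
From mathcomp Require Import all_boot.
From mathcomp Require Import boolp.

Set Implicit Arguments.
Unset Strict Implicit.
Unset Printing Implicit Defensive.

Record sgraph := SGraph {
  vertex :> finType;
  adj : rel vertex;
  adj_sym : symmetric adj;
  adj_irr : irreflexive adj }.

Definition degree (G : sgraph) (v : G) : nat := #|[set w | adj v w]|.

Definition max_degree (G : sgraph) : nat := \max_(v : G) degree v.

Definition connected_set (G : sgraph) (A : {set G}) : Prop :=
  {in A &, forall x y,
     connect (fun u w => [&& u \in A, w \in A & adj u w]) x y}.

(* [B] assigns to each vertex of [H] its branch set in [G]. *)
Definition minor_model (H G : sgraph) (B : H -> {set G}) : Prop :=
  [/\ forall x, B x != set0,
      forall x, connected_set (B x),
      forall x y, x != y -> [disjoint B x & B y]
    & forall x y, adj x y ->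
        exists u w, [/\ u \in B x, w \in B y & adj u w]].

Definition minor (H G : sgraph) : Prop :=
  exists B : H -> {set G}, minor_model B.

(* Invariance under isomorphism is implied, isomorphic graphs being minors of
   each other. *)
Definition minor_closed (P : sgraph -> Prop) : Prop :=
  forall H G : sgraph, minor H G -> P G -> P H.

Definition nontrivial (P : sgraph -> Prop) : Prop :=
  (exists G, P G) /\ (exists G, ~ P G).

(* The graph obtained from [G] by replacing [v] with [j] copies, the [i]-th of
   which is joined to the vertices of [G] other than [v] in [N i]. *)
Section SplitGraph.
Variables (G : sgraph) (v : G) (j : nat) (N : 'I_j -> {set G}).

Definition split_vertex : finType := ({x : G | x != v} + 'I_j)%type.

Definition split_adj (a b : split_vertex) : bool :=
  match a, b with
  | inl x, inl y => adj (val x) (val y)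
  | inl x, inr i => val x \in N i
  | inr i, inl x => val x \in N i
  | inr _, inr _ => false
  end.

Lemma split_adj_sym : symmetric split_adj.
Proof. by move=> [x|i] [y|l] //=; rewrite adj_sym. Qed.

Lemma split_adj_irr : irreflexive split_adj.
Proof. by move=> [x|i] //=; rewrite adj_irr. Qed.

Definition split_graph : sgraph := SGraph split_adj_sym split_adj_irr.

(* The vertices of [S] that remain after the split; copies are excluded. *)
Definition split_rest (S : {set G}) : {set split_graph} :=
  [set a : split_vertex | if a is inl x then val x \in S else false].

End SplitGraph.

(* Having no copy at all (j = 0) is possible only if [v] is isolated. *)
Definition split_op (k : nat) (G : sgraph) (v : G) (j : nat)
    (N : 'I_j -> {set G}) : Prop :=
  [/\ j <= k,
      forall i w, w \in N i -> adj v w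
    & forall w, adj v w -> exists i, w \in N i].

(* [split_seq k G S H]: [H] results from [G] by successive k-split operations
   at vertices of [S], each being split at most once. *)
Inductive split_seq (k : nat) : forall G : sgraph, {set G} -> sgraph -> Prop :=
| split_seq_done (G : sgraph) (S : {set G}) : split_seq k S G
| split_seq_step (G : sgraph) (S : {set G}) (v : G) (j : nat)
    (N : 'I_j -> {set G}) (H : sgraph) :
    v \in S -> split_op k v N -> split_seq k (split_rest v N S) H ->
    split_seq k S H.

Definition is_split (k : nat) (G H : sgraph) : Prop :=
  split_seq k [set: G] H.

Definition splittable (P : sgraph -> Prop) (k : nat) (G : sgraph) : Prop :=
  exists2 H, is_split k G H & P H.

(* [None] stands for infinity. *)
Definition split_thickness (P : sgraph -> Prop) (G : sgraph) : option nat :=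
  if pselect (exists k, (0 < k) && `[< splittable P k G >]) is left ex
  then Some (ex_minn ex) else None.

Definition at_least (t : option nat) (m : nat) : bool :=
  if t is Some k then m <= k else true.

(* Main.v *)
Require Import Defs.
From mathcomp Require Import all_boot.
From mathcomp Require Import zify.
From mathcomp Require Import boolp.

(** A nontrivial minor-closed property fails for some graph X, hence for every
    graph that has the complete graph on t = #|X| vertices as a minor.  It is
    enough to find a graph G of maximum degree five all of whose 2-splits have
    a K_t minor.  Take for G a nearly 5-regular graph of large girth.

    A 2-split H of G has at most 2n vertices, n being the order of G, and it
    maps homomorphically onto G so that every edge of G is the image of an edge
    of H ([split_hom]).  Keep one edge of H over each edge of G
    ([edge_section]): this subgraph has about 5n/2 edges on at most 2n
    vertices, so its average degree is about 5/2, which is more than 2.  Its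
    girth is still large, because a non-backtracking walk in it projects to a
    non-backtracking walk in G.

    Such a graph has a dense minor.  Every graph without isolated vertices has
    a dominating set with at most half of the vertices, and contracting the
    stars centred at such a set keeps the difference between the numbers of
    edges and of vertices when there is no short cycle ([halving]).  Each such
    contraction at least halves the number of vertices and divides the girth by
    at most three.  A difference proportional to the original
    order survives all rounds, so a constant number of them gives any wanted
    average degree ([girth_clique_minor]).  A graph of average degree at least
    2^t has a K_t minor by the classical argument of Mader
    ([dense_clique_minor]).

    For the existence of G, add edges between vertices of degree less than five
    at distance larger than the wanted girth until this is no longer possible.
    Then all the vertices of degree less than five lie in one ball, whose size
    is bounded independently of n ([near_regular]).

    Girth is expressed by non-backtracking walks rather than cycles: they can
    be projected and lifted edge by edge without any injectivity to maintain.
    Edges are counted by [darts], that is, twice. *)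

Set Implicit Arguments.
Unset Strict Implicit.
Unset Printing Implicit Defensive.

(** * Complete graphs, transitivity of minors and darts *)

Section Complete.
Variable T : finType.

Lemma complete_sym : symmetric (fun x y : T => x != y).
Proof. by move=> x y; rewrite eq_sym. Qed.

Lemma complete_irr : irreflexive (fun x y : T => x != y).
Proof. by move=> x; rewrite eqxx. Qed.

Definition complete := SGraph complete_sym complete_irr.

End Complete.

Lemma connected_set1 (G : sgraph) (x : G) : connected_set [set x].
Proof. by move=> u w /set1P-> /set1P->; apply: connect0. Qed.

(** When the branch set is a star, the root [r] is its centre. *)
Lemma connected_root (G : sgraph) (A : {set G}) (r : G) :
    {in A, forall x,
       connect (fun u w => [&& u \in A, w \in A & adj u w]) x r} ->
  connected_set A.
Proof.
move=> Ar x y xA yA; apply: connect_trans (Ar x xA) _.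
rewrite sym_connect_sym ?Ar // => u w; rewrite adj_sym.
by case: (u \in A); case: (w \in A).
Qed.

(** The branch set of a vertex of [F] is the union of the branch sets in [H] of
    the vertices of its branch set in [G]; a path in the latter lifts to the
    union, each step crossing an edge between two connected pieces. *)
Lemma minor_trans (F G H : sgraph) : minor F G -> minor G H -> minor F H.
Proof.
move=> [B [B0 Bc Bd Ba]] [C [C0 Cc Cd Ca]].
pose U x := \bigcup_(y in B x) C y.
have sub (y : G) x : y \in B x -> subrel
    (fun u w => [&& u \in C y, w \in C y & adj u w])
    (connect (fun u w => [&& u \in U x, w \in U x & adj u w])).
  move=> yB u w /and3P[uC wC uw]; apply: connect1.
  by rewrite uw andbT; apply/andP; split; apply/bigcupP; exists y.
exists U; split.
- move=> x; have /set0Pn[y yB] := B0 x; have /set0Pn[u uC] := C0 y.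
  by apply/set0Pn; exists u; apply/bigcupP; exists y.
- move=> x u w /bigcupP[y yB uC] /bigcupP[z zB wC].
  have /connectP[p] := Bc x y z yB zB.
  elim: p y yB u uC => [|y' p IH] y yB u uC /=.
    by move=> _ zy; subst y; apply: (connect_sub (sub z x zB)); apply: Cc.
  case/andP=> /and3P[_ y'B yy'] pth zl.
  have [a [b [aC bC ab]]] := Ca _ _ yy'.
  apply: connect_trans (IH y' y'B b bC pth zl).
  apply: (@connect_trans _ _ a).
    by apply: (connect_sub (sub y x yB)); apply: Cc.
  apply: connect1; rewrite ab andbT.
  by apply/andP; split; apply/bigcupP; [exists y | exists y'].
- move=> x x' xx'; apply/pred0P => u /=; apply/negP=> /andP[].
  case/bigcupP=> y yB uC /bigcupP[z zB uC'].
  have [yz|yz] := eqVneq y z.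
    by have /pred0P/(_ y) /= := Bd x x' xx'; rewrite yB yz zB.
  by have /pred0P/(_ u) /= := Cd y z yz; rewrite uC uC'.
- move=> x x' /Ba[y [z [yB zB /Ca[u [w [uC wC uw]]]]]].
  by exists u, w; split=> //; apply/bigcupP; [exists y | exists z].
Qed.

Lemma minor_sub (H G : sgraph) (g : H -> G) :
  injective g -> (forall x y, adj x y -> adj (g x) (g y)) -> minor H G.
Proof.
move=> g_inj g_adj; exists (fun x => [set g x]); split.
- by move=> x; apply/set0Pn; exists (g x); rewrite inE.
- by move=> x; apply: connected_set1.
- by move=> x y xy; rewrite disjoints1 inE (inj_eq g_inj).
- by move=> x y xy; exists (g x), (g y); rewrite !inE g_adj.
Qed.

Definition darts (G : sgraph) : {set G * G} := [set d | adj d.1 d.2].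

Lemma card_darts (G : sgraph) : #|darts G| = \sum_(v : G) degree v.
Proof.
rewrite -sum1_card (eq_bigl (fun d : G * G => true && adj d.1 d.2)); last first.
  by move=> d; rewrite inE.
rewrite -(pair_big_dep xpredT (@adj G) (fun _ _ => 1)) /=.
apply: eq_bigr => v _; rewrite /degree -sum1_card.
by apply: eq_bigl => w; rewrite inE.
Qed.

(** * Contraction of disjoint stars *)

(** The map [f] sends each vertex of a star to its centre, the centres are the
    elements of [E], and a vertex sent outside [E] is deleted.  Contracting an
    edge, passing to an induced subgraph ([f] the identity) and contracting the
    stars around a dominating set are all of this form. *)
Section StarQuotient.
Variables (G : sgraph) (f : G -> G) (E : {set G}).

Definition quot_adj (x y : {x : G | x \in E}) : bool :=
  (x != y) && [exists u, exists w, [&& f u == val x, f w == val y & adj u w]].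

Lemma quot_adj_sym : symmetric quot_adj.
Proof.
move=> x y; rewrite /quot_adj eq_sym; congr (_ && _).
by apply/existsP/existsP=> -[u /existsP[w /and3P[fu fw uw]]];
  exists w; apply/existsP; exists u; rewrite fu fw adj_sym uw.
Qed.

Lemma quot_adj_irr : irreflexive quot_adj.
Proof. by move=> x; rewrite /quot_adj eqxx. Qed.

Definition quot := SGraph quot_adj_sym quot_adj_irr.

Lemma card_quot : #|quot| = #|E|.
Proof. by rewrite card_sig; apply: eq_card => x. Qed.

Hypothesis f_id : {in E, forall x, f x = x}.
Hypothesis f_adj : forall v, f v \in E -> f v != v -> adj v (f v).

Lemma minor_quot : minor quot G.
Proof.
exists (fun x => [set v | f v == val x]); split.
- by move=> x; apply/set0Pn; exists (val x); rewrite inE f_id // (valP x).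
- move=> x; apply: (@connected_root _ _ (val x)) => v; rewrite inE => /eqP fv.
  have [<-|vx] := eqVneq (val x) v; first exact: connect0.
  apply: connect1; rewrite !inE fv eqxx f_id ?(valP x) // eqxx /=.
  by rewrite -fv f_adj // fv ?(valP x).
- move=> x y xy; apply/pred0P => u /=; rewrite !inE; apply/negP.
  by case/andP=> /eqP-> /eqP/val_inj xy'; rewrite xy' eqxx in xy.
- move=> x y /andP[_ /existsP[u /existsP[w /and3P[fu fw uw]]]].
  by exists u, w; rewrite !inE.
Qed.

(** A family of edges joining distinct stars survives the contraction if no two
    of them join the same pair of stars. *)
Lemma leq_darts_quot (A : {set G * G}) :
    (forall d, d \in A ->
       [/\ adj d.1 d.2, f d.1 \in E, f d.2 \in E & f d.1 != f d.2]) ->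
    {in A &, injective (fun d => (f d.1, f d.2))} ->
  #|A| <= #|darts quot|.
Proof.
move=> A_darts f_inj; rewrite -(card_in_imset f_inj).
pose g (d : quot * quot) := (val d.1, val d.2).
apply: leq_trans (leq_imset_card g _); apply: subset_leq_card.
apply/subsetP=> _ /imsetP[[u w] /A_darts[/= uw uE wE fuw] ->].
apply/imsetP; exists (exist _ (f u) uE, exist _ (f w) wE) => //.
rewrite inE /= /quot_adj -val_eqE /= fuw /=.
by apply/existsP; exists u; apply/existsP; exists w; rewrite !eqxx.
Qed.

End StarQuotient.

(** * Dense graphs have clique minors *)

Section Contraction.
Variables (G : sgraph) (x y : G).
Hypothesis xy : adj x y.

Definition edge_contraction :=
  quot (fun v => if v == y then x else v) (~: [set y]).

Let x_neq_y : x != y.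
Proof. by apply: contraTneq xy => ->; rewrite adj_irr. Qed.

Lemma minor_contraction : minor edge_contraction G.
Proof.
apply: minor_quot => v; rewrite ?inE; first by case: (v == y).
by case: (v =P y) => [-> _ _|_]; rewrite ?eqxx // adj_sym.
Qed.

Lemma card_contraction : #|edge_contraction| = #|G|.-1.
Proof. by rewrite card_quot cardsC1. Qed.

(** Contracting an edge destroys it, and identifies two edges for each common
    neighbour of its ends. *)
Lemma leq_darts_contraction :
  #|darts G| <= #|darts edge_contraction|
                + 2 * #|[set z | adj x z && adj y z]|.+1.
Proof.
set C := [set z | _].
(* The darts between [y] and a vertex of [x |: C] are given up; the other ones
   at [y] move to [x], where they meet no dart already present. *)
pose lost b := (b == x) || adj x b.
pose A := [set d in darts G | ((d.1 == y) ==> ~~ lost d.2)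
                           && ((d.2 == y) ==> ~~ lost d.1)].
have Cx : #|x |: C| = #|C|.+1 by rewrite cardsU1 inE adj_irr.
have lostC a b : adj a b -> a == y -> lost b -> b \in x |: C.
  by move=> ab /eqP ay /orP[bx|xb]; rewrite !inE ?bx // xb -ay ab orbT.
have sub : darts G \subset
    A :|: (setX [set y] (x |: C) :|: setX (x |: C) [set y]).
  apply/subsetP=> -[a b] ab; have {}ab : adj a b by rewrite inE in ab.
  have ba : adj b a by rewrite adj_sym.
  have := lostC a b ab; have := lostC b a ba; rewrite !inE /= ab /=.
  case: (a == y); case: (b == y); case: (lost a); case: (lost b) => //= ha hb;
    try rewrite (ha isT isT); try rewrite (hb isT isT); by rewrite ?orbT.
apply: leq_trans (subset_leq_card sub) _.
apply: leq_trans (leq_card_setU _ _) _; apply: leq_add; last first.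
  by apply: leq_trans (leq_card_setU _ _) _; rewrite !cardsX !cards1 Cx; lia.
have A_in a b : (a, b) \in A ->
    [/\ adj a b, a = y -> ~~ lost b & b = y -> ~~ lost a].
  rewrite !inE /= => /and3P[ab /implyP ha /implyP hb].
  by split=> // /eqP.
apply: leq_darts_quot => [[a b] /A_in[/= ab ha hb]|].
  rewrite !inE; split=> //; first by case: (a =P y) => [_|/eqP].
    by case: (b =P y) => [_|/eqP].
  case: (a =P y) => [ay|_]; case: (b =P y) => [by_|_].
  - by move: ab; rewrite ay by_ adj_irr.
  - by have := ha ay; rewrite /lost negb_or eq_sym => /andP[].
  - by have := hb by_; rewrite /lost negb_or => /andP[].
  - by apply: contraTneq ab => ->; rewrite adj_irr.
move=> [a b] [a' b'] /A_in[/= ab ha hb] /A_in[/= ab' ha' hb'] [].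
move: ha hb ha' hb' ab ab'; rewrite /lost.
case: (a =P y) => [->|_]; case: (a' =P y) => [->|_];
case: (b =P y) => [->|_]; case: (b' =P y) => [->|_];
move=> ha hb ha' hb' ab ab' ea eb; subst=> //; exfalso.
all: try by move: ab; rewrite adj_irr.
all: try by move: ab'; rewrite adj_irr.
all: try by have := ha erefl; rewrite ?eqxx ?ab ?ab' ?orbT.
all: try by have := hb erefl; rewrite ?eqxx ?ab ?ab' ?orbT.
all: try by have := ha' erefl; rewrite ?eqxx ?ab ?ab' ?orbT.
all: try by have := hb' erefl; rewrite ?eqxx ?ab ?ab' ?orbT.
all: try by have := hb erefl; rewrite ?eqxx adj_sym ?ab ?ab' ?orbT.
all: by have := hb' erefl; rewrite ?eqxx adj_sym ?ab ?ab' ?orbT.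
Qed.

End Contraction.

(** The vertex [x] itself serves as the additional branch set. *)
Lemma cone_minor (G : sgraph) (x : G) (t : nat) :
    minor (complete 'I_t) (quot id [set y | adj x y]) ->
  minor (complete 'I_t.+1) G.
Proof.
move=> [B [B0 Bc Bd Ba]].
pose C i := val @: B i.
pose C' (i : 'I_t.+1) : {set G} :=
  if unlift ord0 i is Some k then C k else [set x].
have val_adj (u w : quot id [set y | adj x y]) : adj u w -> adj (val u) (val w).
  case/andP=> _ /existsP[u' /existsP[w' /and3P[/eqP/= <- /eqP<-]]].
  by [].
have x_adj k u : u \in C k -> adj x u.
  by case/imsetP=> v _ ->; have := valP v; rewrite inE.
have adjC k : exists2 u, u \in C k & adj x u.
  have /set0Pn[u uB] := B0 k; exists (val u); first exact: imset_f.
  by apply: (x_adj k); apply: imset_f.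
have disj k : [disjoint [set x] & C k].
  by rewrite disjoints1; apply/negP=> /x_adj; rewrite adj_irr.
exists C'; split; rewrite /C'.
- move=> i; case: unliftP => [k _|_]; apply/set0Pn; last by exists x; rewrite inE.
  by have [u uC _] := adjC k; exists u.
- move=> i; case: unliftP => [k _|_]; last exact: connected_set1.
  move=> _ _ /imsetP[u uB ->] /imsetP[w wB ->].
  have /connectP[p] := Bc k u w uB wB.
  elim: p u uB => [|z p IH] u uB /=; first by move=> _ ->; apply: connect0.
  case/andP=> /and3P[_ zB uz] pth wl.
  apply: connect_trans (IH z zB pth wl); apply: connect1.
  by rewrite !imset_f //= val_adj.
- move=> i j; case: unliftP => [k ->|->]; case: unliftP => [l ->|->].
  + rewrite (inj_eq lift_inj) => kl; apply/pred0P=> u /=; apply/negP.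
    case/andP=> /imsetP[v vB ->] /imsetP[w wB /val_inj vw].
    by have /pred0P/(_ v)/= := Bd k l kl; rewrite vB vw wB.
  + by rewrite disjoint_sym.
  + by [].
  + by rewrite eqxx.
- move=> i j /=; case: unliftP => [k ->|->]; case: unliftP => [l ->|->].
  + rewrite (inj_eq lift_inj) => /(Ba k l)[u [w [uB wB uw]]].
    by exists (val u), (val w); rewrite !imset_f //= val_adj.
  + by have [u uC xu] := adjC k; exists u, x; rewrite inE eqxx adj_sym.
  + by have [u uC xu] := adjC l; exists x, u; rewrite inE eqxx.
  + by rewrite eqxx.
Qed.

(** If the ends of some edge have fewer than 2^t common neighbours, contracting
    it does not lower the density.  Otherwise any neighbourhood induces a graph
    of minimum degree at least 2^t, which has a clique minor on one vertex less
    by induction on [t]. *)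
Lemma dense_clique_minor (t : nat) (G : sgraph) :
  0 < #|G| -> 2 ^ t * #|G| <= #|darts G| -> minor (complete 'I_t) G.
Proof.
elim: t G => [|t IHt] G.
  by move=> _ _; exists (fun i => set0); split; case.
have [n] := ubnP #|G|; elim: n G => // n IHn G Gn G0 dense.
have D0 : 0 < 2 ^ t by rewrite expn_gt0.
have [/existsP[x /existsP[y /andP[xy c_lt]]]|] := boolP
  [exists x : G, exists y, adj x y && (#|[set z | adj x z && adj y z]| < 2 ^ t)].
  have lossy := leq_darts_contraction xy.
  have G2 : 1 < #|G|.
    apply: leq_trans (max_card (mem [set x; y])); rewrite cards2.
    by case: (x =P y) xy => // ->; rewrite adj_irr.
  apply: minor_trans (minor_contraction xy); apply: IHn.
  - by rewrite card_contraction; lia.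
  - by rewrite card_contraction; lia.
  - by rewrite card_contraction; move: dense; rewrite expnS; nia.
move=> /existsPn no_edge.
have [|[[x y]]] := set_0Vmem (darts G).
  by move=> d0; move: dense; rewrite d0 cards0 expnS; nia.
rewrite inE /= => xy; apply: (@cone_minor _ x); apply: IHt.
  by rewrite card_quot; apply/card_gt0P; exists y; rewrite inE.
rewrite card_darts mulnC card_quot -(card_quot id) -sum_nat_const.
apply: leq_sum => u _; have xu := valP u; rewrite inE in xu.
have /existsPn/(_ (val u)) := no_edge x; rewrite xu -leqNgt => /leq_trans; apply.
rewrite /degree; apply: leq_trans (leq_imset_card val _).
apply/subset_leq_card/subsetP=> z; rewrite inE => /andP[xz uz].
have zN : z \in [set z | adj x z] by rewrite inE.
apply/imsetP; exists (exist _ z zN) => //; rewrite inE /= /quot_adj.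
apply/andP; split.
  by rewrite -val_eqE; apply: contraTneq uz => /= ->; rewrite adj_irr.
by apply/existsP; exists (val u); apply/existsP; exists z; rewrite !eqxx.
Qed.

(** * Non-backtracking walks and girth *)

(** Non-backtracking walk x, y, p, of length [(size p).+1]: giving its first
    edge separately makes the condition on consecutive edges structural. *)
Fixpoint nbwalk (G : sgraph) (x y : G) (p : seq G) : bool :=
  adj x y && (if p is z :: p' then (x != z) && nbwalk y z p' else true).

(** In a graph with a cycle, going around it is a closed non-backtracking walk,
    and a shortest closed non-backtracking walk is a cycle; so this says that
    there is no cycle of length at most [L]. *)
Definition girth_gt (G : sgraph) (L : nat) : Prop :=
  forall (x y : G) (p : seq G), nbwalk x y p -> size p < L -> last y p != x.

Lemma nbwalk_neq (G : sgraph) (x y : G) (p : seq G) : nbwalk x y p -> x != y.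
Proof.
by move=> walk; apply: contraTneq walk => ->; case: p => [|? ?]; rewrite /= adj_irr.
Qed.

Lemma nbwalk_path (H : sgraph) (x y : H) (p : seq H) :
  nbwalk x y p -> path (@adj H) x (y :: p).
Proof.
elim: p x y => [|z p IH] x y /=; first by rewrite andbT.
by case/and3P=> -> _ /IH.
Qed.

(** A homomorphism that is injective on neighbourhoods preserves non-backtracking
    walks. *)
Lemma nbwalk_map (G H : sgraph) (g : H -> G) (x y : H) (p : seq H) :
    (forall u v, adj u v -> adj (g u) (g v)) ->
    (forall u v w, adj u v -> adj v w -> u != w -> g u != g w) ->
  nbwalk x y p -> nbwalk (g x) (g y) (map g p).
Proof.
move=> g_adj g_inj; elim: p x y => [|z p IH] x y /=.
  by rewrite !andbT; apply: g_adj.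
case/and3P=> xy xz yzp; rewrite g_adj // (g_inj _ y) ?IH //.
by case: p yzp {IH} => [|? ?] /= /andP[].
Qed.

(** * Large girth and star contraction *)

Section Halving.
Variables (G : sgraph) (f : G -> G) (E : {set G}).
Hypothesis f_id : {in E, forall x, f x = x}.
Hypothesis f_adj : forall v, f v \in E -> f v != v -> adj v (f v).

(** A walk leaving a star at once from its vertex [u] can be started from any
    other vertex [z] of the star, by going first to [u] inside the star, through
    the centre if needed.  The disjunction describes the second vertex of the
    resulting walk, which is what matters when it is extended backwards. *)
Lemma nbwalk_bridge (z u w : G) (p : seq G) :
    nbwalk u w p -> f w != f u -> f z = f u -> f u \in E ->
  exists p', [/\ (z == u) && (p' == w :: p) ||
                 (if p' is y :: q then (f y == f u) && nbwalk z y q else false),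
                 last z p' = last w p & size p' <= (size p).+3].
Proof.
move=> uwp fwu fzu uE.
have [zu|zu] := eqVneq z u; first by exists (w :: p); rewrite eqxx; split=> //=; lia.
have cu : f (f u) = f u by rewrite f_id.
have w_neq v : f v = f u -> v != w by move=> fv; apply: contraNneq fwu => <-; rewrite fv.
have [cz|cz] := eqVneq (f u) z.
  have uz : adj u z by rewrite -cz f_adj // cz.
  exists (u :: w :: p); split=> //=.
  by rewrite eqxx adj_sym uz w_neq // uwp orbT.
have zc : adj z (f u) by rewrite -fzu f_adj ?fzu // cz.
have [cu'|cu'] := eqVneq (f u) u.
  exists (u :: w :: p); split=> //=.
  by move: zc; rewrite eqxx cu' => ->; rewrite w_neq // uwp orbT.
exists (f u :: u :: w :: p); split=> //=.
by rewrite cu eqxx zc zu adj_sym f_adj // w_neq // uwp orbT.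
Qed.

Lemma nbwalk_prepend (a z u w : G) (p : seq G) :
    adj a z -> f a != f z ->
    nbwalk u w p -> f w != f u -> f z = f u -> f u \in E ->
    (z = u -> a != w) ->
  exists p', [/\ nbwalk a z p', last z p' = last w p & size p' <= (size p).+3].
Proof.
move=> az faz uwp fwu fzu uE zua.
have [p' [hp' lp' sp']] := nbwalk_bridge uwp fwu fzu uE.
exists p'; split=> //; case/orP: hp' => [/andP[/eqP zu /eqP->] /=|].
  by rewrite az zua // zu.
case: p' {lp' sp'} => // y q /andP[/eqP fy zyq] /=.
by rewrite az zyq andbT; apply: contraNneq faz => ->; rewrite fy fzu.
Qed.

(** A short walk that leaves a star and comes back to it could be closed inside
    the star. *)
Lemma nbwalk_close (L : nat) (z u w : G) (p : seq G) :
    girth_gt G L -> nbwalk u w p -> f w != f u -> f u \in E ->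
    f z = f u -> last w p = z -> size p + 2 < L ->
  False.
Proof.
move=> gG uwp fwu uE fzu lz sz.
have [p' [hp' lp' sp']] := nbwalk_bridge uwp fwu fzu uE.
case/orP: hp' => [/andP[/eqP zu _]|].
  by have := gG _ _ _ uwp; rewrite lz zu eqxx; lia.
case: p' lp' sp' => //= y q lq sq /andP[_ zyq].
by have := gG _ _ _ zyq; rewrite lq lz eqxx; lia.
Qed.

(** Between two consecutive edges of a walk in the quotient, at most two more
    edges have to be inserted inside a star; when none is inserted, the lifted
    walk does not backtrack because the original one does not. *)
Lemma nbwalk_lift (x y : quot f E) (p : seq (quot f E)) :
    nbwalk x y p ->
  exists u w q, [/\ nbwalk u w q, f u = val x, f w = val y,
                    f (last w q) = val (last y p) & size q <= 3 * size p].
Proof.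
elim: p x y => [|y' p IH] x y /=.
  rewrite andbT => /andP[_ /existsP[u /existsP[w /and3P[/eqP fu /eqP fw uw]]]].
  by exists u, w, [::]; rewrite /= uw.
case/and3P=> /andP[xy /existsP[a /existsP[z /and3P[/eqP fa /eqP fz az]]]] xy'.
move=> walk; case: (IH _ _ walk) => u [w [q [uwq fu fw fl sq]]].
have yy' : val y' != val y by rewrite val_eqE eq_sym (nbwalk_neq walk).
have [||||||q' [aq lq sq']] := @nbwalk_prepend a z u w q az.
- by rewrite fa fz val_eqE.
- by [].
- by rewrite fw fu.
- by rewrite fz fu.
- by rewrite fu (valP y).
- by move=> _; apply: contraNneq xy' => aw; rewrite -val_eqE -fa -fw aw.
exists a, z, q'; rewrite lq fl; split=> //; apply: leq_trans sq' _.
by rewrite mulnS -[(size q).+3]add3n leq_add2l.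
Qed.

Lemma girth_quot (L : nat) : girth_gt G (3 * L) -> girth_gt (quot f E) L.
Proof.
move=> gG x y p walk sp; apply/negP=> /eqP lyp.
have [u [w [q [uwq fu fw fl sq]]]] := nbwalk_lift walk.
have xy := nbwalk_neq walk.
apply: (nbwalk_close gG uwq) (erefl _) _.
- by rewrite fu fw val_eqE eq_sym.
- by rewrite fu (valP x).
- by rewrite fl fu lyp.
- by lia.
Qed.

(* From here on, only isolated vertices may be deleted. *)
Hypothesis f_E : forall u v, adj u v -> f u \in E.

(** Only the edges of the stars are lost: an additional edge inside a star would
    give a triangle, and two edges joining the same pair of stars would give a
    cycle of length at most six. *)
Lemma leq_darts_star_quot :
  girth_gt G 6 -> #|darts G| <= #|darts (quot f E)| + 2 * #|[set v | f v \in E] :\: E|.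
Proof.
move=> gG; set R := _ :\: _.
pose A := [set d in darts G | f d.1 != f d.2].
have sub : darts G \subset
    A :|: ([set (v, f v) | v in R] :|: [set (f v, v) | v in R]).
  apply/subsetP=> -[u w] uw; have {}uw : adj u w by rewrite inE in uw.
  have wu : adj w u by rewrite adj_sym.
  rewrite !in_setU !inE /= uw /=; case: eqP => //= fuw.
  have uE := f_E uw; have wE := f_E wu.
  have [fu|fu] := eqVneq (f u) u.
    apply/orP; right; apply/imsetP; exists w; last by rewrite -fuw fu.
    rewrite !inE wE andbT; apply: contraTN uw => wE'.
    by rewrite -fu fuw (f_id wE') adj_irr.
  have [fw|fw] := eqVneq (f w) w.
    apply/orP; left; apply/imsetP; exists u; last by rewrite fuw fw.
    rewrite !inE uE andbT; apply: contraTN uw => uE'.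
    by rewrite -fw -fuw (f_id uE') adj_irr.
  have wf : adj w (f u) by rewrite fuw f_adj.
  have fuu : adj (f u) u by rewrite adj_sym f_adj.
  have wneu : w != u by apply: contraTneq uw => ->; rewrite adj_irr.
  have walk : nbwalk u w [:: f u; u] by rewrite /= uw wf fuu wneu eq_sym fu.
  by have := gG _ _ _ walk isT; rewrite /= eqxx.
apply: leq_trans (subset_leq_card sub) _.
apply: leq_trans (leq_card_setU _ _) _; apply: leq_add; last first.
  apply: leq_trans (leq_card_setU _ _) _.
  by rewrite mul2n -addnn leq_add ?leq_imset_card.
apply: leq_darts_quot => [[u w]|[u w] [u' w']].
  by rewrite !inE /= => /andP[uw fuw]; rewrite !(f_E uw) (@f_E w u) // adj_sym.
rewrite !inE /= => /andP[uw fuw] /andP[uw' fuw'] [fu fw].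
apply/eqP; rewrite -[_ == _]negbK xpair_eqE negb_and; apply/negP=> ne.
have [|||||p [hp lp sp]] := @nbwalk_prepend u w w' u' [::] uw fuw.
- by rewrite /= adj_sym uw'.
- by [].
- by [].
- by rewrite -fw (@f_E w u) // adj_sym.
- by move=> ww'; move: ne; rewrite ww' eqxx orbF.
apply: (nbwalk_close gG hp) lp _ => //; rewrite ?(f_E uw) //.
- by rewrite eq_sym.
- by move: sp => /=; lia.
Qed.

End Halving.

(** A maximal independent set and its complement both dominate the vertices that
    are not isolated; the smaller of the two provides the centres.  The last
    inequality says that the difference between the numbers of edges and of
    vertices does not decrease. *)
Lemma halving (G : sgraph) (L : nat) :
    2 <= L -> girth_gt G (3 * L) ->
  exists Q : sgraph, [/\ minor Q G, girth_gt Q L, 2 * #|Q| <= #|G|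
    & #|darts G| + 2 * #|Q| <= #|darts Q| + 2 * #|G|].
Proof.
move=> L2 gG.
pose V := [set v : G | [exists w, adj v w]].
pose indep (D : {set G}) := [forall u in D, forall w in D, ~~ adj u w].
have [E Edom E2] : exists2 E : {set G},
    {in V :\: E, forall v, exists2 w, w \in E & adj v w} & 2 * #|E| <= #|V|.
  have indep0 : indep set0 by apply/forall_inP=> u; rewrite inE.
  have [D /maxsetP[/forall_inP indepD maxD] _] := maxset_exists indep0.
  have irrD u w : u \in D -> adj u w -> w \notin D.
    by move=> uD uw; apply: contraL uw => wD; have /forall_inP := indepD u uD; apply.
  have domD v : v \notin D -> exists2 w, w \in D & adj v w.
    move=> vD; case: (boolP [exists w in D, adj v w]) => [/exists_inP[w]|].
      by exists w.
    move/exists_inPn=> no; case/negP: vD; rewrite -(maxD (v |: D)) ?setU11 ?subsetUr //.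
    apply/forall_inP=> a; rewrite !inE => aD; apply/forall_inP=> b; rewrite !inE => bD.
    case/orP: aD => [/eqP->|aD]; case/orP: bD => [/eqP->|bD].
    - by rewrite adj_irr.
    - exact: no.
    - by rewrite adj_sym no.
    - by have /forall_inP := indepD a aD; apply.
  have VD : #|V| = #|D :&: V| + #|V :\: D| by rewrite setIC cardsID.
  have [le|le] := leqP #|D :&: V| #|V :\: D|.
    exists (D :&: V); last by lia.
    move=> v; rewrite !inE => /andP[vDV vV].
    have vD : v \notin D by move: vDV; rewrite vV andbT.
    have [w wD vw] := domD v vD.
    by exists w; rewrite // !inE wD; apply/existsP; exists v; rewrite adj_sym.
  exists (V :\: D); last by lia.
  move=> v; rewrite !inE => /andP[vDV vV]; have /existsP[w vw] := vV.
  have vD : v \in D by move: vDV; rewrite vV andbT negbK.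
  exists w => //; rewrite !inE (irrD v) //.
  by apply/existsP; exists v; rewrite adj_sym.
pose f v := if v \in E then v else odflt v [pick w in E | adj v w].
have f_id : {in E, forall x, f x = x} by move=> x xE; rewrite /f xE.
have f_adj v : f v \in E -> f v != v -> adj v (f v).
  rewrite /f; case: ifP; rewrite ?eqxx //.
  by case: pickP => [w /andP[]|_ _ _] //=; rewrite eqxx.
have f_E u v : adj u v -> f u \in E.
  move=> uv; rewrite /f; case: ifPn => // uE; case: pickP => [w /andP[]|] //=.
  have [|w wE uw] := Edom u; first by rewrite !inE uE; apply/existsP; exists v.
  by move/(_ w); rewrite wE uw.
exists (quot f E); split.
- exact: minor_quot.
- exact: girth_quot.
- by rewrite card_quot; apply: leq_trans E2 (max_card _).
- have g6 : girth_gt G 6 by move=> x y p w s; apply: gG w _; lia.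
  have := leq_darts_star_quot f_id f_adj f_E g6; rewrite card_quot.
  have : #|[set v | f v \in E] :\: E| + #|E| <= #|G|.
    by rewrite addnC -(cardsC E) leq_add2l subset_leq_card // setDE subsetIr.
  by lia.
Qed.

Lemma halvings (k : nat) (G : sgraph) :
    girth_gt G (2 * 3 ^ k) ->
  exists Q : sgraph, [/\ minor Q G, 2 ^ k * #|Q| <= #|G|
    & #|darts G| + 2 * #|Q| <= #|darts Q| + 2 * #|G|].
Proof.
elim: k G => [|k IH] G gG.
  exists G; split; rewrite ?mul1n //.
  by apply: (@minor_sub _ _ id) => // x y.
have [||Q [QG gQ cQ dQ]] := @halving G (2 * 3 ^ k).
- by rewrite leq_pmulr // expn_gt0.
- by rewrite mulnCA -expnS.
have [Q' [Q'Q cQ' dQ']] := IH Q gQ; exists Q'; split; last by lia.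
- exact: minor_trans Q'Q QG.
- by rewrite expnS -mulnA; apply: leq_trans cQ; rewrite leq_mul2l.
Qed.

(** In terms of edges, the number m of edges and the order n satisfy
    m - n >= n / 5.  After t + 2 rounds the order q of the minor is at most
    n / 2^(t + 2), while its number of edges is still at least n / 5, hence at
    least q 2^(t + 2) / 5, which exceeds q 2^t / 2. *)
Lemma girth_clique_minor (t : nat) (G : sgraph) :
    girth_gt G (2 * 3 ^ t.+2) -> 0 < #|G| -> 12 * #|G| <= 5 * #|darts G| ->
  minor (complete 'I_t) G.
Proof.
move=> gG G0 dG; have [Q [QG cQ dQ]] := halvings gG.
apply: minor_trans QG; apply: dense_clique_minor; last first.
  by move: cQ; rewrite !expnS; move: (2 ^ t) => D; nia.
rewrite lt0n; apply/eqP=> Q0.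
have dQ0 : #|darts Q| = 0.
  apply/eqP; rewrite -leqn0; apply: leq_trans (max_card _) _.
  by rewrite card_prod Q0.
by lia.
Qed.

(** * Nearly regular graphs of large girth *)

Section Ball.
Variables (G : sgraph) (u : G).

Fixpoint ball (k : nat) : {set G} :=
  if k is k'.+1 then \bigcup_(x in ball k') (x |: [set w | adj x w])
  else [set u].

Lemma card_ball (d k : nat) :
  (forall v : G, degree v <= d) -> #|ball k| <= d.+1 ^ k.
Proof.
move=> dG; elim: k => [|k IH] /=; first by rewrite cards1.
have le : #|\bigcup_(x in ball k) (x |: [set w | adj x w])|
          <= \sum_(x in ball k) d.+1.
  elim/big_rec2: _ => [|x m A _ IHA]; first by rewrite cards0.
  apply: leq_trans (leq_card_setU _ _) _; apply: leq_add IHA.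
  by apply: leq_trans (leq_card_setU _ _) _; rewrite cards1 add1n ltnS dG.
by apply: leq_trans le _; rewrite sum_nat_const expnSr leq_mul2r IH orbT.
Qed.

Lemma ball_path (x : G) (i k : nat) (p : seq G) :
  x \in ball i -> path (@adj G) x p -> size p + i <= k -> last x p \in ball k.
Proof.
elim: p x i => [|y p IH] x i xi /=.
  move=> _; elim: k => [|k IHk]; first by rewrite leqn0 => /eqP i0; rewrite -i0.
  rewrite leq_eqVlt => /orP[/eqP<-//|/IHk xk] /=.
  by apply/bigcupP; exists x; rewrite // setU11.
case/andP=> xy yp le; apply: (IH _ i.+1) => //; last by rewrite addnS.
by apply/bigcupP; exists x; rewrite // !inE xy orbT.
Qed.

End Ball.

Lemma last_in_ball (G : sgraph) (x : G) (k : nat) (p : seq G) :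
  path (@adj G) x p -> size p <= k ->
  last x p \in ball x k /\ x \in ball (last x p) k.
Proof.
move=> xp pk; split; first by apply: (@ball_path _ _ x 0) xp _; rewrite ?inE ?addn0.
have rp : path (@adj G) (last x p) (rev (belast x p)).
  by rewrite rev_path (eq_path (e' := @adj G)) // => a b; rewrite adj_sym.
have lx : last (last x p) (rev (belast x p)) = x.
  by case: (p) => // y q; rewrite /= rev_cons last_rcons.
have := @ball_path _ (last x p) (last x p) 0 k _ _ rp; rewrite lx.
by apply; rewrite ?inE // size_rev size_belast addn0.
Qed.

(** Joining two vertices at distance larger than [L] creates no cycle of length
    at most [L]. *)
Section AddEdge.
Variables (G : sgraph) (u v : G).
Hypothesis uv : u != v.

Definition new_edge (x y : G) : bool :=
  (x == u) && (y == v) || (x == v) && (y == u).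

Definition add_adj (x y : G) : bool := adj x y || new_edge x y.

Lemma new_edge_sym : symmetric new_edge.
Proof. by move=> x y; rewrite /new_edge orbC andbC [in X in _ || X]andbC. Qed.

Lemma add_adj_sym : symmetric add_adj.
Proof. by move=> x y; rewrite /add_adj adj_sym new_edge_sym. Qed.

Lemma add_adj_irr : irreflexive add_adj.
Proof.
move=> x; rewrite /add_adj /new_edge adj_irr /=.
by case: (x =P u) => [->|_]; rewrite ?andbF ?(negbTE uv).
Qed.

Definition add_edge := SGraph add_adj_sym add_adj_irr.

Lemma degree_add_edge (x : G) :
  @degree add_edge x <= degree x + ((x == u) || (x == v)).
Proof.
have sub : [set w | @adj add_edge x w] \subset
    [set w | adj x w] :|: (if x == u then [set v] else
                           if x == v then [set u] else set0).
  apply/subsetP=> w; rewrite !inE /= /add_adj /new_edge => /orP[->//|].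
  case/orP=> /andP[/eqP-> /eqP->].
    by rewrite eqxx inE eqxx orbT.
  by rewrite (eq_sym v u) (negbTE uv) eqxx inE eqxx orbT.
apply: leq_trans (subset_leq_card sub) _.
apply: leq_trans (leq_card_setU _ _) _; rewrite /degree leq_add2l.
by case: (x == u); [|case: (x == v)]; rewrite ?cards1 ?cards0.
Qed.

Variable L : nat.
Hypothesis gG : girth_gt G L.
Hypothesis far_uv : v \notin ball u L.
Hypothesis far_vu : u \notin ball v L.

Lemma new_edge_far (x y : G) (p : seq G) :
  new_edge x y -> path (@adj G) y p -> size p <= L -> last y p != x.
Proof.
move=> xy yp sp; have [yl _] := last_in_ball yp sp.
case/orP: xy yl => /andP[/eqP-> /eqP->] yl.
- by apply: contraNneq far_vu => <-.
- by apply: contraNneq far_uv => <-.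
Qed.

(** A short walk uses the new edge at most once.  It does not turn back along
    it, and between two uses separated by edges of [G] it would go from one end
    to the other, which is too far, or come back to the same end, which
    contradicts the girth of [G]. *)
Lemma nbwalk_add_edge (x y : G) (p : seq G) :
    @nbwalk add_edge x y p -> size p < L ->
  [\/ nbwalk x y p, new_edge x y /\ path (@adj G) y p
    | exists p1 b p2, [/\ p = p1 ++ b :: p2, nbwalk x y p1,
        new_edge (last y p1) b & path (@adj G) b p2]].
Proof.
elim: p x y => [|z p IH] x y /=.
  by rewrite andbT /add_adj => /orP[xy|xy] _; [constructor 1; rewrite xy | constructor 2].
case/and3P=> xy xz walk sp.
have {IH} := IH y z walk (ltnW sp).
case/orP: xy => xy.
  case=> [yzp|[yz zp]|[p1 [b [p2 [-> yzp1 new bp2]]]]].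
  - by constructor 1; rewrite xy xz.
  - by constructor 3; exists [::], z, p; rewrite /= xy.
  - by constructor 3; exists (z :: p1), b, p2; rewrite /= xy xz.
case=> [yzp|[yz zp]|[p1 [b [p2 [ep yzp1 new bp2]]]]].
- by constructor 2; split=> //; apply: (nbwalk_path yzp).
- exfalso; move: xy yz xz; rewrite /new_edge.
  case/orP=> /andP[/eqP-> /eqP->]; rewrite ?eqxx ?(negbTE uv) ?andbF //= 1?eq_sym.
    by rewrite (negbTE uv) /= => /eqP->; rewrite eqxx.
  by rewrite orbF => /eqP->; rewrite eqxx.
- exfalso; have sp1 : size p1 < L.
    by move: sp; rewrite ep size_cat /=; lia.
  have ly := gG yzp1 sp1.
  have lx := new_edge_far xy (nbwalk_path yzp1) sp1.
  rewrite /= in lx.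
  move: xy new lx ly; rewrite /new_edge.
  by case/orP=> /andP[/eqP-> /eqP->];
     case/orP=> /andP[/eqP-> _]; rewrite ?eqxx.
Qed.

Lemma girth_add_edge : girth_gt add_edge L.
Proof.
move=> x y p walk sp; apply/negP=> /eqP lx.
case: (nbwalk_add_edge walk sp) => [xyp|[xy yp]|[p1 [b [p2 [ep xyp1 new bp2]]]]].
- by have := gG xyp sp; rewrite lx eqxx.
- by have := new_edge_far xy yp (ltnW sp); rewrite lx eqxx.
(* Rotated to start just after the new edge, the closed walk joins the ends of
   this edge in [G]. *)
have bx : last b p2 = x by rewrite -lx ep last_cat.
have pth : path (@adj G) b (p2 ++ y :: p1).
  by rewrite cat_path bp2 bx; apply: nbwalk_path.
have sp' : size (p2 ++ y :: p1) <= L by move: sp; rewrite ep !size_cat /=; lia.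
by have := new_edge_far new pth sp'; rewrite last_cat /= eqxx.
Qed.

End AddEdge.

Lemma ball_sym (G : sgraph) (u v : G) (k : nat) : v \in ball u k -> u \in ball v k.
Proof.
suff : v \in ball u k -> exists p, [/\ path (@adj G) u p, size p <= k & last u p = v].
  by move=> ex /ex[p [up pk <-]]; have [] := last_in_ball up pk.
elim: k v => [|k IH] v /=; first by rewrite inE => /eqP->; exists [::].
case/bigcupP=> x /IH[p [up pk <-]]; rewrite !inE => /orP[/eqP->|pv].
  by exists p; split=> //; apply: leqW.
by exists (rcons p v); rewrite rcons_path up last_rcons size_rcons.
Qed.

(** As long as two vertices of degree less than [d] are at distance larger than
    [L], they can be joined; this stops because the order is fixed. *)
Lemma girth_saturation (d L : nat) (G : sgraph) : 0 < L ->
    (forall v : G, degree v <= d) -> girth_gt G L ->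
  exists H : sgraph, [/\ #|H| = #|G|, forall v : H, degree v <= d,
    girth_gt H L & {in [set v : H | degree v < d] &, forall u v, v \in ball u L}].
Proof.
move=> L0; have [m] := ubnP (#|G| * #|G| - #|darts G|).
elim: m G => // m IH G Gm dG gG.
pose S := [set v : G | degree v < d].
case: (boolP [forall u in S, forall v in S, v \in ball u L]) => [/forall_inP SB|].
  by exists G; split=> // u v uS vS; have /forall_inP := SB u uS; apply.
case/forall_inPn=> u uS /forall_inPn[v vS far_uv].
have xx (x : G) k : x \in ball x k.
  by have [] := @last_in_ball G x k [::] isT isT.
have uv : u != v by apply: contraNneq far_uv => ->.
have far_vu : u \notin ball v L.
  by apply: contraNN far_uv => /ball_sym.
have more : #|darts G| < #|darts (add_edge uv)|.
  apply: proper_card; apply/properP; split.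
    by apply/subsetP=> e; rewrite !inE /= /add_adj => ->.
  exists (u, v); rewrite !inE /= /add_adj /new_edge ?eqxx ?orbT //.
  apply: contraNN far_uv => auv; case: (L) L0 => // l _.
  by have [] := @last_in_ball G u l.+1 [:: v]; rewrite /= ?auv.
have small : #|darts (add_edge uv)| <= #|G| * #|G|.
  by apply: leq_trans (max_card _) _; rewrite card_prod.
have [|||H [cH dH gH SH]] := IH (add_edge uv); last by exists H.
- by move: Gm more small; rewrite -/(#|G|); lia.
- move=> x; apply: leq_trans (degree_add_edge uv x) _.
  rewrite !inE in uS vS.
  case: (eqVneq x u) => [->|_]; first by rewrite addn1.
  by case: (eqVneq x v) => [->|_]; rewrite ?addn1 ?addn0.
- exact: girth_add_edge.
Qed.

Lemma edgeless_graph (n : nat) :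
  exists G : sgraph, #|G| = n /\ forall x y : G, ~~ adj x y.
Proof.
by exists (@SGraph 'I_n (fun _ _ => false) (fun _ _ => erefl) (fun _ => erefl));
   split; rewrite ?card_ord.
Qed.

(** When no edge can be added any more, the vertices of degree less than [d] are
    pairwise close, so a ball around one of them contains them all. *)
Lemma near_regular (d L n : nat) : 0 < L ->
  exists G : sgraph, [/\ #|G| = n, forall v : G, degree v <= d, girth_gt G L
    & #|[set v : G | degree v < d]| <= d.+1 ^ L].
Proof.
move=> L0; have [G0 [cG0 G0e]] := edgeless_graph n.
have [||G [cG dG gG SG]] := @girth_saturation d L G0 L0.
- move=> v; rewrite /degree (eq_card0 (A := [set w | adj v w])) // => w.
  by rewrite !inE; apply: negbTE.
- by move=> x y p xyp; have := nbwalk_path xyp; rewrite /= (negbTE (G0e x y)).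
exists G; split; rewrite ?cG //.
have [->|[u uS]] := set_0Vmem [set v : G | degree v < d].
  by rewrite cards0.
apply: leq_trans (card_ball u L dG).
by apply/subset_leq_card/subsetP=> v; apply: SG.
Qed.

(** * Splits of a graph *)

(** Sending each copy to the vertex it comes from is a homomorphism onto [G] that
    covers all its edges, and a split adds at most [k - 1] vertices for each
    vertex allowed to be split. *)
Lemma split_hom (k : nat) (G H : sgraph) (S : {set G}) :
    0 < k -> split_seq k S H ->
  #|H| + #|S| <= #|G| + k * #|S| /\
  exists g : H -> G, (forall a b, adj a b -> adj (g a) (g b)) /\
    (forall u w, adj u w -> exists a b, [/\ adj a b, g a = u & g b = w]).
Proof.
move=> k0; elim=> {G S H} [G S|G S v j N H vS [jk Nadj adjN] _ [cH [g [g_hom g_cov]]]].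
  split; first by rewrite leq_add2l leq_pmull.
  by exists id; split=> // u w uw; exists u, w.
split.
  have cS : #|split_rest v N S| = #|S|.-1.
    rewrite (cardsD1 v S) vS /= /split_rest.
    have <- : #|[set x : {x : G | x != v} | val x \in S]| = #|S :\ v|.
      rewrite -(card_imset _ val_inj); apply: eq_card => x; rewrite !inE.
      apply/imsetP/andP => [[y yS ->]|[xv xS]].
        by rewrite inE in yS; split=> //; exact: (valP y).
      by exists (exist _ x xv); rewrite ?inE.
    rewrite -(card_imset _ (@inl_inj {x : G | x != v} 'I_j)).
    apply: eq_card => -[x|i]; rewrite !inE.
      by rewrite mem_imset ?inE //; apply: inl_inj.
    by apply/esym/negP=> /imsetP[].
  have cG : #|split_graph v N| = #|G|.-1 + j.
    rewrite card_sum card_ord card_sig; congr (_ + _).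
    by rewrite -(cardC1 v); apply: eq_card.
  have S0 : 0 < #|S| by apply/card_gt0P; exists v.
  have G0 : 0 < #|G| by apply/card_gt0P; exists v.
  move: cH; rewrite cS cG; move: S0 G0 jk.
  by case: #|S| => // s _; case: #|G| => // n _ /=; rewrite mulnS; lia.
pose h (a : split_graph v N) := if a is inl x then val x else v.
have h_hom a b : adj a b -> adj (h a) (h b).
  case: a b => [x|i] [y|l] //= /Nadj //.
  by rewrite adj_sym.
have h_cov u w : adj u w -> exists a b, [/\ adj a b, h a = u & h b = w].
  move=> uw; case: (eqVneq u v) => [uv|uv]; case: (eqVneq w v) => [wv|wv].
  - by move: uw; rewrite uv wv adj_irr.
  - have [|i wN] := adjN w; first by rewrite -uv.
    by exists (inr i), (inl (exist _ w wv)); split.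
  - have [|i uN] := adjN u; first by rewrite -wv adj_sym.
    by exists (inl (exist _ u uv)), (inr i); split.
  - by exists (inl (exist _ u uv)), (inl (exist _ w wv)); split.
exists (h \o g); split=> [a b /g_hom/h_hom //|u w /h_cov[a [b [ab <- <-]]]].
by have [a' [b' [ab' <- <-]]] := g_cov a b ab; exists a', b'.
Qed.

(** A spanning subgraph of [H] with exactly one edge over each edge of [G] has
    as many edges as [G] and inherits its girth. *)
Section EdgeSection.
Variables (G H : sgraph) (g : H -> G).
Hypothesis g_hom : forall a b : H, adj a b -> adj (g a) (g b).
Hypothesis g_cov : forall u w : G, adj u w ->
  exists a b, [/\ adj a b, g a = u & g b = w].

Definition lift_edge (u w : G) : option (H * H) :=
  [pick d : H * H | [&& adj d.1 d.2, g d.1 == u & g d.2 == w]].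

(** Each edge of [G] is lifted in one of its two directions only, the one given
    by the enumeration of the vertices, so that the result is symmetric. *)
Definition section_adj (a b : H) : bool :=
  if enum_rank (g a) < enum_rank (g b) then lift_edge (g a) (g b) == Some (a, b)
  else lift_edge (g b) (g a) == Some (b, a).

Lemma lift_edgeP (u w : G) (a b : H) :
  lift_edge u w = Some (a, b) -> [/\ adj a b, g a = u & g b = w].
Proof.
by rewrite /lift_edge; case: pickP => // d /and3P[ab /eqP ga /eqP gb] [ed];
   move: ab ga gb; rewrite ed.
Qed.

Lemma section_adjW (a b : H) : section_adj a b -> adj a b.
Proof.
rewrite /section_adj; case: ifP => _ /eqP/lift_edgeP[] //.
by rewrite adj_sym.
Qed.

Lemma rank_lt (u w : G) :
  adj u w -> (enum_rank w < enum_rank u) = ~~ (enum_rank u < enum_rank w).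
Proof.
move=> uw; rewrite -leqNgt ltn_neqAle.
case: eqP => // /ord_inj/enum_rank_inj wu.
by move: uw; rewrite wu adj_irr.
Qed.

Lemma section_adj_sym : symmetric section_adj.
Proof.
move=> a b; apply/idP/idP => ab; have := g_hom (section_adjW ab) => gab.
all: have := rank_lt gab; move: ab; rewrite /section_adj.
all: by case: (_ < _) => ab ->.
Qed.

Lemma section_adj_irr : irreflexive section_adj.
Proof. by move=> a; apply/negP=> /section_adjW; rewrite adj_irr. Qed.

Definition edge_section := SGraph section_adj_sym section_adj_irr.

Lemma section_inj (a b a' b' : edge_section) :
  adj a b -> adj a' b' -> g a = g a' -> g b = g b' -> a = a' /\ b = b'.
Proof.
move=> /= + + ga gb; rewrite /section_adj ga gb.
by case: ifP => _ /eqP-> /eqP[-> ->].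
Qed.

Lemma section_cov (u w : G) : adj u w ->
  exists a b : edge_section, [/\ adj a b, g a = u & g b = w].
Proof.
have lift x y : adj x y -> exists a b, lift_edge x y = Some (a, b).
  move=> /g_cov[a [b [ab ga gb]]]; rewrite /lift_edge.
  case: pickP => [[c d] _|/(_ (a, b))]; first by exists c, d.
  by rewrite /= ab ga gb !eqxx.
move=> uw; have wu : adj w u by rewrite adj_sym.
have [lt|ge] := boolP (enum_rank u < enum_rank w).
  have [a [b ab]] := lift u w uw; have [_ ga gb] := lift_edgeP ab.
  by exists a, b; rewrite /= /section_adj ga gb lt ab.
have [a [b ab]] := lift w u wu; have [_ ga gb] := lift_edgeP ab.
by exists b, a; rewrite /= /section_adj ga gb (negbTE ge) ab.
Qed.

Lemma minor_section : minor edge_section H.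
Proof. by apply: (@minor_sub edge_section H id) => //; apply: section_adjW. Qed.

Lemma leq_darts_section : #|darts G| <= #|darts edge_section|.
Proof.
pose h (d : edge_section * edge_section) := (g d.1, g d.2).
apply: leq_trans (leq_imset_card h _); apply/subset_leq_card/subsetP=> -[u w].
rewrite inE => /section_cov[a [b [ab ga gb]]].
by apply/imsetP; exists (a, b); rewrite ?inE // /h /= ga gb.
Qed.

(** Two distinct neighbours of a vertex have distinct images, as only one edge is
    kept over each edge of [G]. *)
Lemma girth_section (L : nat) : girth_gt G L -> girth_gt edge_section L.
Proof.
move=> gG x y p walk sp; apply/negP=> /eqP lx.
have walkG : nbwalk (g x) (g y) (map g p).
  apply: (@nbwalk_map G edge_section) walk => [u v /section_adjW/g_hom //|].
  move=> u v w uv vw; apply: contra_neq => guw.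
  have wv : @adj edge_section w v by rewrite adj_sym.
  by have [] := section_inj uv wv guw erefl.
by have := gG _ _ _ walkG; rewrite size_map last_map lx eqxx => /(_ sp).
Qed.

End EdgeSection.

(** The constant comes from the ratio 12 / 5 of darts to vertices needed for a
    clique minor, the split having twice as many vertices. *)
Lemma split_clique_minor (t : nat) (G H : sgraph) (k : nat) :
    0 < k <= 2 -> girth_gt G (2 * 3 ^ t.+2) -> 0 < #|G| ->
    24 * #|G| <= 5 * #|darts G| -> is_split k G H ->
  minor (complete 'I_t) H.
Proof.
case/andP=> k0 k2 gG G0 dG /(split_hom k0)[]; rewrite cardsT => cH [g [g_hom g_cov]].
have dH := leq_darts_section g_hom g_cov.
apply: minor_trans (minor_section g_hom); apply: girth_clique_minor.
- exact: girth_section.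
- have : 0 < #|darts G| by lia.
  by case/card_gt0P=> -[u w]; rewrite inE => /g_cov[a _]; apply/card_gt0P; exists a.
- by move: cH dH; rewrite -/(#|edge_section g_hom|); nia.
Qed.

(** * Split thickness *)

Theorem theorem3 (P : sgraph -> Prop) (P_minor : minor_closed P)
    (P_nontrivial : nontrivial P) :
  exists G : sgraph,
    max_degree G = 5 /\ at_least (split_thickness P G) 3.
Proof.
have [_ [X notPX]] := P_nontrivial.
pose L := 2 * 3 ^ #|X|.+2.
(* With 25 * 6 ^ L vertices, at most 6 ^ L of them of degree less than five,
   there are at least 5 * 24 * 6 ^ L = 24 / 5 * #|G| darts. *)
have [|G [cG dG gG SG]] := @near_regular 5 L (25 * 6 ^ L).
  by rewrite muln_gt0 expn_gt0.
have B0 : 0 < 6 ^ L by rewrite expn_gt0.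
set S := [set v : G | degree v < 5] in SG.
have SC := cardsC S.
have SG' : forall v, v \in ~: S -> degree v = 5.
  by move=> v; rewrite !inE -leqNgt => v5; apply/eqP; rewrite eqn_leq dG.
have darts_G : 5 * #|~: S| <= #|darts G|.
  rewrite card_darts mulnC -sum_nat_const [X in _ <= X](bigID (mem (~: S))) /=.
  by apply: leq_trans (leq_addr _ _); apply: leq_sum => v /SG' ->.
exists G; split.
  apply/eqP; rewrite eqn_leq; apply/andP; split.
    by apply/bigmax_leqP => v _; apply: dG.
  have /card_gt0P[v /SG' <-] : 0 < #|~: S| by lia.
  exact: leq_bigmax.
rewrite /split_thickness; case: pselect => //= ex.
case: ex_minnP => k /andP[k0 /asboolP[H GH PH]] _.
rewrite leqNgt; apply/negP=> k2; apply: notPX; apply: P_minor PH.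
have KH : minor (complete 'I_#|X|) H.
  by apply: (split_clique_minor _ gG _ _ GH); lia.
apply: minor_trans KH; apply: (@minor_sub X (complete 'I_#|X|) enum_rank).
  exact: enum_rank_inj.
move=> x y xy /=; rewrite (inj_eq enum_rank_inj).
by apply: contraTneq xy => ->; rewrite adj_irr.
Qed.
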